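(* The infinite surgery-sum graph $K_\infty$ is not Gromov hyperbolic.
   Context: $\Sigma_g$ denotes a closed oriented surface of genus $g\ge 1$. A collection $\Gamma$ of closed curves on $\Sigma_g$ in generic position (only transverse double points) is regarded as a 4-valent graph embedded in $\Sigma_g$: vertices are the intersection points, edges are the arcs between them. It is one-faced if $\Sigma_g\setminus\Gamma$ is a single open disk. Cutting $\Sigma_g$ along a one-faced $\Gamma$ gives a polygon $P_\Gamma$ with $8g-4$ sides; each edge of $\Gamma$ gives two sides, and the sides of $P_\Gamma$ are called the oriented edges of $\Gamma$ ($x$ and $\bar x$ denote the two sides of the same edge). Up to homeomorphism there is exactly one one-faced collection on the torus, denoted $\Gamma_{\mathbb T}$ (two simple closed curves meeting transversally once). Surgery: let $x,y$ be two oriented edges of a one-faced collection $\Gamma$ belonging to distinct edges of $\Gamma$. Let $\lambda_{x,y}$ be the simple arc, unique up to homotopy, whose interior is disjoint from $\Gamma$ (it lies in the interior of $P_\Gamma$) and which joins an interior point of the side $x$ to an interior point of the side $y$. The collection $\sigma_{x,y}(\Gamma)$ is obtained by cutting open $\Gamma$ along $\lambda_{x,y}$: remove from each of the two edges a small open subarc around the endpoint of $\lambda_{x,y}$, and join the four resulting ends by two disjoint parallel copies of $\lambda_{x,y}$, one on each side of $\lambda_{x,y}$. When $\sigma_{x,y}(\Gamma)$ is one-faced, the operation $\Gamma\to\sigma_{x,y}(\Gamma)$ is called a surgery. The surgery graph $K_g$ has as vertices the homeomorphism classes of one-faced collections on $\Sigma_g$; two distinct vertices are joined by an edge if they have representatives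 connected by a surgery. Connected sum: let $\Gamma_1,\Gamma_2$ be one-faced collections on $\Sigma_{g_1},\Sigma_{g_2}$, with oriented edges $x$ of $\Gamma_1$ and $y$ of $\Gamma_2$. Form the connected sum of surfaces $\Sigma_{g_1}\#\Sigma_{g_2}$ along open disks disjoint from $\Gamma_1$ and $\Gamma_2$; the complement of $\Gamma_1\cup\Gamma_2$ is an annulus. Take a simple arc $\lambda$ with interior in this annulus from the side $x$ to the side $y$ and contract it to a point. The resulting one-faced collection $(\Gamma_1\cup\Gamma_2\cup\lambda)/\lambda$ on a surface of genus $g_1+g_2$ is the connected sum $(\Gamma_1,x)\#(\Gamma_2,y)$. When $\Gamma_2=\Gamma_{\mathbb T}$ the result does not depend, up to homeomorphism, on the choice of $y$, and is written $(\Gamma_1,x)\#\Gamma_{\mathbb T}$. The graph $\widehat K_g$ is the disjoint union $\bigsqcup_{1\le i\le g}K_i$ together with an additional edge between (the classes of) $\Gamma_1\in K_i$ and $\Gamma_2\in K_{i+1}$, $1\le i<g$, whenever $\Gamma_2$ is (up to homeomorphism) $(\Gamma_1,x)\#\Gamma_{\mathbb T}$ for some oriented edge $x$ of $\Gamma_1$. The infinite surgery-sum graph $K_\infty$ is the union of the increasing sequence $\widehat K_1\subset\widehat K_2\subset\cdots$; that is, its vertex set is $\bigsqcup_{i\ge1}K_i$, with all surgery edges and all connected-sum edges. It is a geodesic metric space with each edge of length 1. A geodesic metric space $X$ is Gromov hyperbolic if there exists $\delta\ge 0$ such that for every geodesic triangle, the $\delta$-neighborhood of the union of any two sides contains the third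 side. *)

(* Defs.v *)
From HB Require Import structures.
From mathcomp Require Import all_boot all_order all_algebra.
From mathcomp Require Import generic_quotient.
From mathcomp Require Import all_classical all_reals all_analysis.

Set Implicit Arguments.
Unset Strict Implicit.
Unset Printing Implicit Defensive.

Import Order.TTheory GRing.Theory Num.Theory.

(** * One-faced collections of curves

    A graph cellularly embedded in a closed oriented surface is encoded, up to
    orientation-preserving homeomorphism, by its combinatorial map. A dart [x]
    is both the half-edge leaving a vertex and the oriented edge starting with
    that half-edge; as a side of the cut-open surface, it is the side of the
    edge that has the face on its left. [bar] exchanges the two darts of an edge
    and [rotation] maps a half-edge to the next one around its vertex, clockwise.
    With these conventions [rotation (bar x)] is the side following [x] along the
    boundary of the face to the left of [x], so that faces are the orbits of
    [next_side]. *)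

Section Maps.
Variable D : finType.

Definition dart_map : Type := ({ffun D -> D} * {ffun D -> D})%type.

Definition rotation (M : dart_map) : {ffun D -> D} := M.1.
Definition bar (M : dart_map) : {ffun D -> D} := M.2.

Definition next_side (M : dart_map) (x : D) : D := rotation M (bar M x).

(* The last conjunct also makes the graph connected. *)
Definition one_faced (M : dart_map) : bool :=
  [&& injectiveb (rotation M), [forall x, fingraph.order (rotation M) x == 4],
      [forall x, (bar M (bar M x) == x) && (bar M x != x)]
    & fcard (next_side M) D == 1].

(* The arc from the middle of side [x] to the middle of side [y] cuts the polygon
   so that the second half of [x], which is the half-edge [bar x], lies together
   with the first half of [y], which is the half-edge [y]; a parallel copy of the
   arc joins them. The other copy joins [x] to [bar y]. Half-edges keep their
   positions around the vertices. *)
Definition surgery (M : dart_map) (x y : D) : dart_map :=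
  (rotation M,
   [ffun z => if z == x then bar M y
              else if z == bar M y then x
              else if z == y then bar M x
              else if z == bar M x then y
              else bar M z]).

End Maps.

(* Homeomorphisms may reverse the orientation, hence the rotation. *)
Definition homeomorphic (D1 D2 : finType) (M1 : dart_map D1) (M2 : dart_map D2)
    : bool :=
  [exists f : {ffun D1 -> D2},
    [&& injectiveb f, #|D1| == #|D2|,
        [forall x, f (bar M1 x) == bar M2 (f x)]
      & [forall x, f (rotation M1 x) == rotation M2 (f x)]
        || [forall x, rotation M2 (f (rotation M1 x)) == f x]]].

(** ** Connected sum

    Contracting the arc merges the midpoints of the edges of [x] and [y] into a
    new vertex with half-edges 0, 1, 2, 3 in clockwise order, which are
    matched with [x], [bar y], [y], [bar x] respectively: the former edge of [x]
    and the former edge of [y] are each split in two, and the annulus [x] and [y]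
    bound becomes the corners between 0 and 1 and between 2 and 3. *)

Section ConnectedSum.
Variables (D1 D2 : finType) (M1 : dart_map D1) (x : D1).
Variables (M2 : dart_map D2) (y : D2).

Definition sum_darts : finType := ((D1 + D2) + 'I_4)%type.

Definition sum_rotation (d : sum_darts) : sum_darts :=
  match d with
  | inl (inl a) => inl (inl (rotation M1 a))
  | inl (inr b) => inl (inr (rotation M2 b))
  | inr i => inr (inord (i.+1 %% 4))
  end.

Definition sum_bar (d : sum_darts) : sum_darts :=
  match d with
  | inl (inl a) => if a == x then inr (inord 0)
                   else if a == bar M1 x then inr (inord 3)
                   else inl (inl (bar M1 a))
  | inl (inr b) => if b == y then inr (inord 2)
                   else if b == bar M2 y then inr (inord 1)
                   else inl (inr (bar M2 b))
  | inr i => match val i with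
             | 0 => inl (inl x)
             | 1 => inl (inr (bar M2 y))
             | 2 => inl (inr y)
             | _ => inl (inl (bar M1 x))
             end
  end.

Definition connected_sum : dart_map sum_darts :=
  ([ffun d => sum_rotation d], [ffun d => sum_bar d]).

End ConnectedSum.

(* One vertex; each of the two loops joins opposite half-edges. *)
Definition torus_collection : dart_map 'I_4 :=
  ([ffun i : 'I_4 => inord (i.+1 %% 4)], [ffun i : 'I_4 => inord (i.+2 %% 4)]).

(** ** Homeomorphism classes

    A one-faced 4-valent graph with [8g-4] darts has [2g-1] vertices, [4g-2]
    edges and one face, so its surface has Euler characteristic [2-2g]. There is
    no such object for [g = 0], because [next_side] has no orbit then. *)

Definition collection (g : nat) : Type :=
  {M : dart_map 'I_(8 * g - 4) | one_faced M}.

Definition homeo (g : nat) (G H : collection g) : bool :=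
  homeomorphic (val G) (val H).

Lemma homeo_refl g : reflexive (@homeo g).
Proof.
move=> G; apply/fintype.existsP; exists [ffun x => x]; rewrite eqxx /=.
apply/and3P; split.
- by apply/injectiveP => x y; rewrite !ffunE.
- by apply/forallP => x; rewrite !ffunE.
- by apply/orP; left; apply/forallP => x; rewrite !ffunE.
Qed.

Lemma homeo_sym g : symmetric (@homeo g).
Proof.
suff imp (G H : collection g) : homeo G H -> homeo H G.
  by move=> G H; apply/idP/idP; apply: imp.
case/fintype.existsP => f /and4P[/injectiveP fI _ /forallP fb fr].
have [k fK kK] := injF_bij fI.
apply/fintype.existsP; exists [ffun x => k x]; rewrite eqxx /=.
apply/and3P; split.
- by apply/injectiveP => x y; rewrite !ffunE; apply: (can_inj kK).
- apply/forallP => x; rewrite !ffunE; apply/eqP/fI.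
  by rewrite (eqP (fb _)) !kK.
- case/orP: fr => /forallP fr; apply/orP; [left | right]; apply/forallP => x;
    rewrite !ffunE; apply/eqP.
    by apply: fI; rewrite (eqP (fr _)) !kK.
  have rI : injective (rotation (val G)) by case/and4P: (valP G) => /injectiveP.
  have [r rK Kr] := injF_bij rI.
  have := eqP (fr (r (k x))); rewrite Kr !kK => ->.
  by rewrite fK Kr.
Qed.

Lemma homeo_trans g : transitive (@homeo g).
Proof.
move=> H G K.
case/fintype.existsP => f /and4P[/injectiveP fI _ /forallP fb fr].
case/fintype.existsP => h /and4P[/injectiveP hI _ /forallP hb hr].
apply/fintype.existsP; exists [ffun x => h (f x)]; rewrite eqxx /=.
apply/and3P; split.
- by apply/injectiveP => x y; rewrite !ffunE => /hI/fI.
- by apply/forallP => x; rewrite !ffunE (eqP (fb _)) (eqP (hb _)).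
- case/orP: fr => /forallP fr; case/orP: hr => /forallP hr; apply/orP;
    [left | right | right | left]; apply/forallP => x; rewrite !ffunE; apply/eqP.
  + by rewrite (eqP (fr _)) (eqP (hr _)).
  + by rewrite (eqP (fr _)) (eqP (hr _)).
  + by rewrite -(eqP (hr _)) (eqP (fr _)).
  + by rewrite -(eqP (fr x)) (eqP (hr _)).
Qed.

Canonical homeo_equiv g :=
  EquivRel (@homeo g) (@homeo_refl g) (@homeo_sym g) (@homeo_trans g).

Definition homeo_class (g : nat) : choiceType := {eq_quot @homeo g}%qT.

Definition class_of (g : nat) (G : collection g) : homeo_class g :=
  (\pi_(homeo_class g) G)%qT.

(** * The infinite surgery-sum graph *)

Definition Kinf_vertex : choiceType := {g : nat & homeo_class g}.

Definition Kinf_mk (g : nat) (c : homeo_class g) : Kinf_vertex :=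
  Tagged homeo_class c.

Inductive Kinf_link : Kinf_vertex -> Kinf_vertex -> Prop :=
| surgery_link (g : nat) (G H : collection g) (x y : 'I_(8 * g - 4)) :
    y != x -> y != bar (val G) x ->
    val H = surgery (val G) x y ->
    class_of G <> class_of H ->
    Kinf_link (Kinf_mk (class_of G)) (Kinf_mk (class_of H))
| sum_link (g : nat) (G : collection g) (H : collection g.+1)
    (x : 'I_(8 * g - 4)) (y : 'I_4) :
    homeomorphic (connected_sum (val G) x torus_collection y) (val H) ->
    Kinf_link (Kinf_mk (class_of G)) (Kinf_mk (class_of H)).

Definition Kinf_edge (u v : Kinf_vertex) : Prop := Kinf_link u v \/ Kinf_link v u.

(** * Geometric realization of a simple graph *)

Local Open Scope classical_set_scope.
Local Open Scope ring_scope.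

Section Realization.
Variables (R : realType) (V : choiceType) (e : V -> V -> Prop).

(* Barycentric coordinates of the point at distance [t] from [u] on edge [uv]. *)
Definition edge_point (u v : V) (t : R) : V -> R :=
  fun w => (1 - t) * (w == u)%:R + t * (w == v)%:R.

(* The case [u = v] only matters for isolated vertices. *)
Definition is_graph_point (p : V -> R) : Prop :=
  exists u v t, [/\ u = v \/ e u v, 0 <= t <= 1 & p = edge_point u v t].

Definition graph_point : Type := {p : V -> R | is_graph_point p}.

(* [polyline p q l]: there is a piecewise linear path of length [l] from [p] to
   [q], each edge having length 1. *)
Inductive polyline : (V -> R) -> (V -> R) -> R -> Prop :=
| polyline_nil p : polyline p p 0
| polyline_cons u v s t q l :
    e u v -> 0 <= s <= 1 -> 0 <= t <= 1 ->
    polyline (edge_point u v t) q l ->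
    polyline (edge_point u v s) q (`|s - t| + l).

(* The value is +oo between distinct connected components. *)
Definition graph_dist (p q : graph_point) : \bar R :=
  ereal_inf [set l%:E | l in polyline (sval p) (sval q)].

End Realization.

(** * Gromov hyperbolicity *)

Section Hyperbolicity.
Variables (R : realType) (X : Type) (d : X -> X -> \bar R).

Definition geodesic_segment (a b : X) (S : set X) : Prop :=
  exists (l : R) (c : R -> X),
    [/\ 0 <= l, c 0 = a, c l = b,
        forall s t, 0 <= s <= l -> 0 <= t <= l -> d (c s) (c t) = `|s - t|%:E
      & S = c @` [set s | 0 <= s <= l]].

Definition neighborhood (delta : R) (A : set X) : set X :=
  [set p | exists2 q, A q & (d p q <= delta%:E)%E].

Definition gromov_hyperbolic : Prop :=
  exists2 delta : R, 0 <= delta &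
    forall (a b c : X) (S1 S2 S3 : set X),
      geodesic_segment a b S1 -> geodesic_segment b c S2 ->
      geodesic_segment c a S3 ->
      [/\ S1 `<=` neighborhood delta (S2 `|` S3),
          S2 `<=` neighborhood delta (S3 `|` S1)
        & S3 `<=` neighborhood delta (S1 `|` S2)].

End Hyperbolicity.

Definition Kinf_dist (R : realType) :
    graph_point R Kinf_edge -> graph_point R Kinf_edge -> \bar R :=
  @graph_dist R Kinf_vertex Kinf_edge.

(* Main.v *)
(** The genus and the number of curves are both 1-Lipschitz on the vertices of
    K_infinity: a surgery preserves the genus and changes the number of curves by
    at most 1, and a connected sum with the torus increases both by 1. Take a
    chain of tori. The i-th torus can be switched, by a surgery, to a position
    with one more curve, and this commutes with everything done elsewhere. Start
    from a chain of n+1 tori, none switched, and reach 2n+1 tori, n of them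
    switched, either by n sums and then n surgeries or in the opposite order. The
    number of curves grows by 1 at each step, so both paths are geodesic; but the
    corner of the second one has the initial genus and n more curves, and no point
    of the first one is within about n/2 of it. *)

Require Import Defs.
From mathcomp Require Import all_boot all_order all_algebra.
From mathcomp Require Import zify ring lra.
From mathcomp Require Import generic_quotient.
From mathcomp Require Import all_classical all_reals all_analysis.

Set Implicit Arguments.
Unset Strict Implicit.
Unset Printing Implicit Defensive.

(** * Darts of the torus collection *)

Local Notation ord4 k := (inord k : 'I_4).

Lemma ord4_ind (P : 'I_4 -> Prop) :
  P (ord4 0) -> P (ord4 1) -> P (ord4 2) -> P (ord4 3) -> forall i, P i.
Proof.
move=> P0 P1 P2 P3 i; rewrite -(inord_val i).
by case: (val i) (ltn_ord i) => [|[|[|[|//]]]].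
Qed.

Lemma ord4_eq a b : a < 4 -> b < 4 -> (ord4 a == ord4 b) = (a == b).
Proof. by move=> a4 b4; rewrite -val_eqE /= !inordK. Qed.

Local Arguments torus_collection : simpl never.

Lemma rotation_torus k :
  k < 4 -> rotation torus_collection (ord4 k) = ord4 (k.+1 %% 4).
Proof. by move=> k4; rewrite ffunE inordK. Qed.

Lemma bar_torus k : k < 4 -> bar torus_collection (ord4 k) = ord4 (k.+2 %% 4).
Proof. by move=> k4; rewrite ffunE inordK. Qed.

Definition torusE := (rotation_torus, bar_torus).

(** * Four-valence and connectedness of the boundary *)

Section OneFaced.
Variable D : finType.
Implicit Types (M : dart_map D) (f : D -> D).

(** The first condition makes the order divide 4; the second excludes 1 and 2. *)
Lemma order_eq4 f z : injective f ->
  (fingraph.order f z == 4) = (iter 4 f z == z) && (f (f z) != z).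
Proof.
move=> fI; apply/eqP/andP => [f_ord | [/eqP f4 f2]].
  split; first by rewrite -{1}f_ord iter_order.
  have := orbit_uniq f z; rewrite /orbit f_ord /= !inE !negb_or.
  by rewrite (eq_sym z (f (f z))) => /andP[/and3P[_ -> _] _].
have f1 : f z != z by apply: contraNneq f2 => e; rewrite !e.
have f3 : f (f (f z)) != z.
  by apply: contraNneq f1 => e; rewrite -[X in f X]e; apply/eqP; exact: f4.
rewrite (@order_cycle _ f [:: z; f z; f (f z); f (f (f z))]) ?mem_head//=.
  by rewrite !eqxx /= andbT; apply/eqP.
by rewrite !inE !negb_or !(inj_eq fI) !(eq_sym z) f1 f2 f3.
Qed.

Definition four_valent M : Prop :=
  [/\ forall z, iter 4 (rotation M) z = z,
      forall z, rotation M (rotation M z) != z,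
      forall z, bar M (bar M z) = z
    & forall z, bar M z != z].

(** A single boundary orbit, expressed through invariant functions: later proofs follow equalities
    of values from side to side instead of computing orbits. *)
Definition connected_boundary M : Prop :=
  forall h : D -> bool, (forall z, h (next_side M z) = h z) ->
  forall z w, h z = h w.

(** The indicator of the orbit of [z0] is invariant, hence constant, so this orbit contains
    everything. *)
Lemma fcard1P f (z0 : D) : injective f ->
  (forall h : D -> bool, (forall z, h (f z) = h z) -> forall z w, h z = h w) ->
  fcard f D = 1.
Proof.
move=> fI fc; have sf := fconnect_sym fI.
rewrite -(n_comp_connect sf z0); apply: eq_n_comp_r => z.
rewrite inE; apply/esym.
rewrite -[RHS](connect0 (frel f) z0); apply: (fc (fun z => fconnect f z0 z)) => w.
by rewrite -same_fconnect1_r.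
Qed.

Lemma fcard1_invariant f (h : D -> bool) : injective f -> fcard f D = 1 ->
  (forall z, h (f z) = h z) -> forall z w, h z = h w.
Proof.
move=> fI f1 hf z w; have sf := fconnect_sym fI.
have hc u v : fconnect f u v -> h v = h u.
  by case/connectP => p /fpathP[n ->] ->; rewrite last_traject;
    elim: n => //= n; rewrite hf.
suff /eqP : froot f z == froot f w.
  by move=> e; rewrite -(hc _ _ (connect_root _ z)) e (hc _ _ (connect_root _ w)).
have /card_le1_eqP : #|predI (froots f) (mem D)| <= 1 by rewrite -f1.
by move=> /(_ (froot f z) (froot f w)) ->; rewrite // inE /= roots_root.
Qed.

(** The last condition excludes the empty map, whose boundary is vacuously connected but has no
    orbit. *)
Lemma one_facedP M :
  one_faced M <-> [/\ four_valent M, connected_boundary M & exists z : D, true].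
Proof.
split.
  case/and4P => /injectiveP rI /forallP r4 /forallP bM /eqP f1.
  have b2 z : bar M (bar M z) = z by case/andP: (bM z) => /eqP.
  have nI : injective (next_side M) by move=> z w /rI /(can_inj b2).
  split.
  - split=> // z; [move: (r4 z)|move: (r4 z)|by case/andP: (bM z)].
      by rewrite order_eq4 // => /andP[/eqP].
    by rewrite order_eq4 // => /andP[].
  - by move=> h hn; apply: fcard1_invariant hn.
  - have : 0 < fcard (next_side M) D by rewrite f1.
    by case/card_gt0P => z _; exists z.
case=> -[r4 r2 b2 b1] cM [z0 _].
have rI : injective (rotation M).
  by apply: (can_inj (g := fun z => iter 3 (rotation M) z)) => z; exact: r4.
have nI : injective (next_side M) by move=> z w /rI /(can_inj b2).
apply/and4P; split.
- exact/injectiveP.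
- by apply/forallP => z; rewrite order_eq4 // r4 eqxx r2.
- by apply/forallP => z; rewrite b2 eqxx b1.
- by rewrite (fcard1P z0).
Qed.

End OneFaced.

Lemma leq_card_image (S T : finType) (A : {set S}) (B : {set T}) (f : S -> T) :
  {in A, forall a, f a \in B} -> {in A &, injective f} -> #|A| <= #|B|.
Proof.
move=> AB fI; rewrite -(card_in_imset fI); apply/subset_leq_card.
by apply/fintype.subsetP => _ /imsetP[a aA ->]; exact: AB.
Qed.

(** * Colourings and the number of curves *)

(* Invariance under [rotation ^ 2] and [bar] means being constant along each
   curve, hence a collection of [k] curves has [2 ^ k] colourings. *)
Definition colorings (D : finType) (M : dart_map D) : {set {ffun D -> bool}} :=
  [set f : {ffun D -> bool} | [forall z,
    (f (bar M z) == f z) && (f (rotation M (rotation M z)) == f z)]].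

Lemma coloringsP (D : finType) (M : dart_map D) (f : {ffun D -> bool}) :
  reflect ((forall z, f (bar M z) = f z) /\
           (forall z, f (rotation M (rotation M z)) = f z))
          (f \in colorings M).
Proof.
rewrite inE; apply: (iffP forallP) => [fM | [fb fr] z].
  by split=> z; case/andP: (fM z) => /eqP ? /eqP.
by rewrite fb fr !eqxx.
Qed.

(** Colourings are transported by composition. Reversing the orientation inverts the rotation, and
    invariance under its square is the same as invariance under the inverse of that square. *)
Lemma card_colorings_homeo (D1 D2 : finType) (M1 : dart_map D1)
    (M2 : dart_map D2) :
  homeomorphic M1 M2 -> #|colorings M1| = #|colorings M2|.
Proof.
case/fintype.existsP => f /and4P[/injectiveP fI /eqP cD /forallP fb fr].
have [k fK kK] : bijective f by apply: inj_card_bij; rewrite // cD.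
have f_col (g : {ffun D2 -> bool}) :
    (g \in colorings M2) = ([ffun z => g (f z)] \in colorings M1).
  have gbar z : (g (bar M2 (f z)) == g (f z)) =
      ([ffun z => g (f z)] (bar M1 z) == [ffun z => g (f z)] z).
    by rewrite !ffunE (eqP (fb z)).
  apply/coloringsP/coloringsP => -[gb gr]; split=> z.
  - by apply/eqP; rewrite -gbar gb.
  - rewrite !ffunE; case/orP: fr => /forallP fr.
      by rewrite !(eqP (fr _)) gr.
    by rewrite -(gr (f _)) !(eqP (fr _)).
  - by rewrite -(kK z); apply/eqP; rewrite gbar gb.
  - rewrite -(kK z); case/orP: fr => /forallP fr.
      by have := gr (k z); rewrite !ffunE !(eqP (fr _)).
    have rI : injective (rotation M1).
      by move=> x y e; apply: fI; rewrite -(eqP (fr x)) -(eqP (fr y)) e.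
    have [r _ Kr] := injF_bij rI.
    have := gr (r (r (k z))); rewrite !ffunE !Kr => ->.
    by rewrite -[in LHS](Kr (k z)) -[in LHS](Kr (r _)) !(eqP (fr _)).
apply/eqP; rewrite eqn_leq; apply/andP; split.
  apply: (leq_card_image (f := fun g : {ffun D1 -> bool} => [ffun z => g (k z)])).
    move=> g gM; rewrite f_col; suff -> : [ffun z => [ffun z => g (k z)] (f z)] = g by [].
    by apply/ffunP => z; rewrite !ffunE fK.
  by move=> g h _ _ /ffunP e; apply/ffunP => z; have := e (f z); rewrite !ffunE fK.
apply: (leq_card_image (f := fun g : {ffun D2 -> bool} => [ffun z => g (f z)])).
  by move=> g; rewrite f_col.
by move=> g h _ _ /ffunP e; apply/ffunP => z; have := e (k z); rewrite !ffunE kK.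
Qed.

(** If some colouring [f0] separates [x] from [y], adding it modulo 2 sends the separating
    colourings injectively to the agreeing ones. *)
Lemma card_colorings_agree (D : finType) (M : dart_map D) (x y : D) :
  #|colorings M| <= 2 * #|[set f in colorings M | f x == f y]|.
Proof.
set A := [set f in _ | _].
have AC : A \subset colorings M by apply/fintype.subsetP => f; rewrite inE => /andP[].
rewrite -(cardsID A) (finset.setIidPr AC) mul2n -addnn leq_add2l.
have [-> | [f0]] := set_0Vmem (colorings M :\: A); first by rewrite cards0.
rewrite !inE => /andP[+ f0M]; rewrite f0M /= => f0xy.
apply: (leq_card_image (f := fun f : {ffun D -> bool} => [ffun z => f z (+) f0 z])).
  move=> f; rewrite !inE => /andP[+ fM]; rewrite fM /= => fxy.
  apply/andP; split; last first.
    by rewrite !ffunE; move: fxy f0xy;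
      case: (f x) (f y) (f0 x) (f0 y) => [] [] [] [].
  move: fM f0M => /forallP fM /forallP f0M; apply/forallP => z; rewrite !ffunE.
  by case/andP: (fM z) => /eqP -> /eqP ->;
    case/andP: (f0M z) => /eqP -> /eqP ->; rewrite !eqxx.
move=> f g _ _ /ffunP e; apply/ffunP => z; have := e z; rewrite !ffunE.
exact: addIb.
Qed.

(** A function with equal values at [x] and [y] is a colouring before the surgery exactly when it is
    one after it, since only the darts of these two edges are recombined. By [card_colorings_agree],
    such functions are at least half of the colourings on either side. *)
Lemma card_colorings_surgery (D : finType) (M : dart_map D) (x y : D) :
  four_valent M -> y != x -> y != bar M x ->
  #|colorings M| <= 2 * #|colorings (surgery M x y)| /\
  #|colorings (surgery M x y)| <= 2 * #|colorings M|.
Proof.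
move=> [_ _ b2 b1] yx ybx.
have ybxC : (x == bar M y) = false by apply: contraNF ybx => /eqP ->; rewrite b2.
have bxy : (bar M x == bar M y) = false.
  by apply: contraNF yx => /eqP /(can_inj b2) ->.
have barE z : bar (surgery M x y) z = if z == x then bar M y
              else if z == bar M y then x
              else if z == y then bar M x
              else if z == bar M x then y
              else bar M z by rewrite ffunE.
split; apply: leq_trans (card_colorings_agree _ x y) _;
  rewrite leq_mul2l /=; apply/subset_leq_card/fintype.subsetP => f;
  rewrite inE => /andP[/coloringsP[fb fr] /eqP fxy];
  apply/coloringsP; split=> // z.
  rewrite barE; case: eqP => [-> |_]; first by rewrite fb.
  case: eqP => [-> |_]; first by rewrite fb.
  case: eqP => [-> |_]; first by rewrite fb.
  by case: eqP => [-> |_]; rewrite fb.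
have := fb z; rewrite barE; case: eqP => [-> fby |_].
  have := fb y; rewrite barE (negPf yx) eqxx eq_sym (negPf (b1 y)) => ->.
  by rewrite fxy.
case: eqP => [-> <-|_]; first by rewrite b2 fxy.
case: eqP => [-> _|_]; first by rewrite -fxy -[RHS](fb x) barE eqxx.
by case: eqP => [-> <-|_]; rewrite ?b2 ?fxy.
Qed.

(** * Transport of maps to the standard dart sets *)

Section Relabel.
Variables (D : finType) (n : nat) (cardD : #|D| = n).
Implicit Types (M : dart_map D) (x y z : D).

Definition label (z : D) : 'I_n := cast_ord cardD (enum_rank z).
Definition unlabel (i : 'I_n) : D := enum_val (cast_ord (esym cardD) i).

Lemma labelK : cancel label unlabel.
Proof. by move=> z; rewrite /unlabel cast_ordK enum_rankK. Qed.

Lemma unlabelK : cancel unlabel label.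
Proof. by move=> i; rewrite /label enum_valK cast_ordKV. Qed.

Lemma label_eq x y : (label x == label y) = (x == y).
Proof. exact/inj_eq/can_inj/labelK. Qed.

Definition relabel M : dart_map 'I_n :=
  ([ffun i => label (rotation M (unlabel i))],
   [ffun i => label (bar M (unlabel i))]).

Lemma rotation_relabel M z :
  rotation (relabel M) (label z) = label (rotation M z).
Proof. by rewrite ffunE labelK. Qed.

Lemma bar_relabel M z : bar (relabel M) (label z) = label (bar M z).
Proof. by rewrite ffunE labelK. Qed.

Lemma homeomorphic_relabel M : homeomorphic M (relabel M).
Proof.
apply/fintype.existsP; exists [ffun z => label z]; apply/and4P; split.
- by apply/injectiveP => x y; rewrite !ffunE => /(can_inj labelK).
- by rewrite card_ord cardD.
- by apply/forallP => z; rewrite !(ffunE label) bar_relabel.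
- by apply/orP; left; apply/forallP => z; rewrite !(ffunE label) rotation_relabel.
Qed.

Lemma one_faced_relabel M : one_faced M -> one_faced (relabel M).
Proof.
case/one_facedP => -[r4 r2 b2 b1] cM [z0 _].
apply/one_facedP; split; last by exists (label z0).
  split=> i; rewrite -(unlabelK i) /= ?rotation_relabel ?bar_relabel.
  - by congr label; exact: r4.
  - by rewrite label_eq.
  - by rewrite b2.
  - by rewrite label_eq.
move=> h hM i j; rewrite -(unlabelK i) -(unlabelK j).
apply: (cM (fun z => h (label z))) => z.
by rewrite -(hM (label z)) /next_side bar_relabel rotation_relabel.
Qed.

Lemma relabel_surgery M x y :
  relabel (surgery M x y) = surgery (relabel M) (label x) (label y).
Proof.
congr pair; apply/ffunP => i; rewrite -(unlabelK i) [LHS]ffunE [RHS]ffunE labelK.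
rewrite !bar_relabel !label_eq ffunE.
by do 4!case: ifP => // _.
Qed.

End Relabel.

(** * Colourings of a connected sum with the torus *)

Lemma even_involution (D : finType) (s : D -> D) (A : {pred D}) :
  (forall z, s (s z) = z) -> (forall z, s z != z) ->
  (forall z, (s z \in A) = (z \in A)) -> ~~ odd #|A|.
Proof.
move=> sK s1 sA; have sI := can_inj sK.
rewrite -(@fcard_order_set _ _ sI 2 A) ?muln2 ?odd_double //.
  apply/fintype.subsetP => z _; rewrite inE (@order_cycle _ s [:: z; s z]) ?mem_head //=.
    by rewrite sK !eqxx.
  by rewrite inE eq_sym s1.
by move=> z w /eqP <-.
Qed.

(* A parity argument: [rotation ^ 2] pairs off the darts of colour [true], and
   [bar] pairs off those that are not on the edge of [x]. *)
Lemma cut_coloring (D : finType) (M : dart_map D) (x : D) (f : D -> bool) :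
  four_valent M -> (forall z, f (rotation M (rotation M z)) = f z) ->
  (forall z, z != x -> z != bar M x -> f (bar M z) = f z) ->
  f (bar M x) = f x.
Proof.
move=> [r4 r2 b2 b1] fr fb.
have evA : ~~ odd #|[pred z | f z]|.
  by apply: (even_involution (s := fun z => rotation M (rotation M z))).
have := evA; rewrite (cardD1 x) (cardD1 (bar M x)) !oddD.
set B := [predD1 _ & bar M x].
have /negPf -> : ~~ odd #|B|.
  apply: (even_involution (s := bar M)) => // z; rewrite !inE.
  have -> : (bar M z == bar M x) = (z == x) by apply/inj_eq/can_inj/b2.
  have -> : (bar M z == x) = (z == bar M x).
    by rewrite -[x in LHS]b2; apply/inj_eq/can_inj/b2.
  case: (eqVneq z x) => //= zx; rewrite ?andbF //.
  by case: (eqVneq z (bar M x)) => //= zbx; rewrite fb.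
by rewrite !inE b1 /=; case: (f x) (f (bar M x)) => [] [].
Qed.

(** The first two darts form the loop of [y], the last two the other loop. *)
Lemma torus_darts (y t : 'I_4) :
  [\/ t = y, t = bar torus_collection y, t = rotation torus_collection y
    | t = rotation torus_collection (rotation torus_collection
            (rotation torus_collection y))].
Proof.
suff : [|| t == y, t == bar torus_collection y, t == rotation torus_collection y
    | t == rotation torus_collection (rotation torus_collection
            (rotation torus_collection y))].
  by case/or4P => /eqP; [constructor 1|constructor 2|constructor 3|constructor 4].
by elim/ord4_ind: y; elim/ord4_ind: t; rewrite !rotation_torus ?bar_torus // !ord4_eq.
Qed.

Lemma rotation2_torus (t : 'I_4) :
  rotation torus_collection (rotation torus_collection t) =
  bar torus_collection t.
Proof. by elim/ord4_ind: t; rewrite !torusE. Qed.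

Lemma bar_torusK : involutive (bar torus_collection).
Proof. by move=> t; elim/ord4_ind: t; rewrite !bar_torus. Qed.

Lemma rotation_torus_neq (t : 'I_4) :
  (rotation torus_collection t == t) = false /\
  (rotation torus_collection t == bar torus_collection t) = false.
Proof.
by elim/ord4_ind: t; rewrite !bar_torus // !rotation_torus // !ord4_eq.
Qed.

Lemma one_faced_torus : one_faced torus_collection.
Proof.
apply/one_facedP; split; last by exists (ord4 0).
  split=> t; elim/ord4_ind: t; rewrite /= ?torusE ?ord4_eq //.
move=> h hT.
have h1 := hT (ord4 1); have h2 := hT (ord4 2); have h3 := hT (ord4 3).
rewrite /next_side !bar_torus // !rotation_torus // in h1 h2 h3.
have h0 t : h t = h (ord4 0).
  by elim/ord4_ind: t => //; rewrite h1 ?h2 ?h3.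
by move=> z w; rewrite !h0.
Qed.

Section TorusSum.
Variables (D : finType) (M : dart_map D) (x : D).
Hypothesis fM : four_valent M.

Local Notation T := torus_collection.
Local Notation old a := (inl (inl a) : sum_darts D 'I_4).
Local Notation tor t := (inl (inr t) : sum_darts D 'I_4).
Local Notation new k := (inr (inord k) : sum_darts D 'I_4).

Lemma rotation_sum (y : 'I_4) :
  [/\ forall a, rotation (connected_sum M x T y) (old a) = old (rotation M a),
      forall t, rotation (connected_sum M x T y) (tor t) = tor (rotation T t)
    & forall k, k < 4 ->
        rotation (connected_sum M x T y) (new k) = new (k.+1 %% 4)].
Proof. by split=> [a|t|k k4]; rewrite ffunE /= ?inordK. Qed.

Lemma bar_sum_old (y : 'I_4) a : bar (connected_sum M x T y) (old a) =
  if a == x then new 0 else if a == bar M x then new 3 else old (bar M a).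
Proof. by rewrite ffunE. Qed.

Lemma bar_sum_tor (y t : 'I_4) : bar (connected_sum M x T y) (tor t) =
  if t == y then new 2 else if t == bar T y then new 1 else tor (bar T t).
Proof. by rewrite ffunE. Qed.

Lemma bar_sum_new (y : 'I_4) :
  [/\ bar (connected_sum M x T y) (new 0) = old x,
      bar (connected_sum M x T y) (new 1) = tor (bar T y),
      bar (connected_sum M x T y) (new 2) = tor y
    & bar (connected_sum M x T y) (new 3) = old (bar M x)].
Proof. by split; rewrite ffunE /= inordK. Qed.

(** The loop of [y] merges with the curve of [x], so a colouring of the sum amounts to a colouring
    of [M] and a free colour for the other loop. *)
Lemma card_colorings_sum (y : 'I_4) :
  #|colorings (connected_sum M x T y)| = 2 * #|colorings M|.
Proof.
have [r4 r2 b2 b1] := fM.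
have [rold rtor rnew] := rotation_sum y.
have [bn0 bn1 bn2 bn3] := bar_sum_new y.
have barT := can_inj bar_torusK.
have cardE : 2 * #|colorings M| = #|finset.setX (colorings M) [set: bool]|.
  by rewrite cardsX cardsT card_bool mulnC.
apply/eqP; rewrite eqn_leq cardE; apply/andP; split.
  apply: (leq_card_image (f := fun f : {ffun sum_darts D 'I_4 -> bool} =>
    ([ffun a => f (old a)], f (tor (rotation T y))))).
    move=> f /coloringsP[fb fr]; rewrite finset.in_setX finset.in_setT andbT /=.
    apply/coloringsP.
    have gr z : f (old (rotation M (rotation M z))) = f (old z).
      by rewrite -!rold fr.
    have gb z : z != x -> z != bar M x -> f (old (bar M z)) = f (old z).
      by move=> /negPf zx /negPf zbx; rewrite -[RHS]fb bar_sum_old zx zbx.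
    split=> z; rewrite !ffunE //.
    (* The sum has cut the edge of [x], so no single edge relates its two ends any more; parity
       does. *)
    have gbx := @cut_coloring _ M x (fun a => f (old a)) fM gr gb.
    case: (eqVneq z x) => [->|zx]; first exact: gbx.
    by case: (eqVneq z (bar M x)) => [->|zbx]; [rewrite b2 gbx | exact: gb].
  move=> f g /coloringsP[fb fr] /coloringsP[gb gr] [/ffunP eold etor].
  have {}eold a : f (old a) = g (old a) by have := eold a; rewrite !ffunE.
  have e0 : f (new 0) = g (new 0) by rewrite -fb -gb bn0.
  have e3 : f (new 3) = g (new 3) by rewrite -fb -gb bn3.
  have e2 : f (new 2) = g (new 2) by rewrite -fr -gr !rnew.
  have e1 : f (new 1) = g (new 1) by rewrite -fr -gr !rnew.
  apply/ffunP => -[[a|t]|i]; first exact: eold; last by elim/ord4_ind: i.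
  case: (torus_darts y t) => -> //.
  - by rewrite -bn2 fb gb.
  - by rewrite -bn1 fb gb.
  - by rewrite -!rtor fr gr rtor.
(* The new vertex and the loop of [y] all take the colour of [x]. *)
apply: (leq_card_image (f := fun hb : {ffun D -> bool} * bool =>
  [ffun d : sum_darts D 'I_4 => match d with
     | inl (inl a) => hb.1 a
     | inl (inr t) => if (t == y) || (t == bar T y) then hb.1 x else hb.2
     | inr _ => hb.1 x end])).
  case=> h b; rewrite finset.in_setX finset.in_setT andbT => /coloringsP[hb hr].
  set F := finfun _.
  have Fold a : F (old a) = h a by rewrite ffunE.
  have Ftor t : F (tor t) = if (t == y) || (t == bar T y) then h x else b.
    by rewrite ffunE.
  have Fnew i : F (inr i) = h x by rewrite ffunE.
  apply/coloringsP; split=> -[[a|t]|i].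
  - rewrite bar_sum_old; case: eqP => [->|_]; first by rewrite Fnew Fold.
    by case: eqP => [->|_]; rewrite ?Fnew Fold hb.
  - rewrite bar_sum_tor Ftor; have [ty|ty] := eqVneq t y; first by rewrite Fnew.
    have [tby|tby] := eqVneq t (bar T y); first by rewrite Fnew.
    rewrite Ftor (inj_eq barT) -[y in bar T t == y]bar_torusK (inj_eq barT).
    by rewrite (negPf ty) (negPf tby).
  - elim/ord4_ind: i; rewrite ?bn0 ?bn1 ?bn2 ?bn3 ?Ftor ?Fold Fnew ?eqxx ?orbT //.
  - by rewrite !rold !Fold.
  - rewrite !rtor !Ftor rotation2_torus (inj_eq barT) -[y in bar T t == y]bar_torusK.
    by rewrite (inj_eq barT) orbC.
  - by elim/ord4_ind: i; rewrite !rnew // !Fnew.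
case=> h b [k c] _ _ /= /ffunP e; congr pair.
  by apply/ffunP => a; have := e (old a); rewrite !ffunE.
have := e (tor (rotation T y)); rewrite 2!(ffunE _ (tor _)).
by have [-> ->] := rotation_torus_neq y.
Qed.

End TorusSum.

(** * Attaching a torus *)

(* The sum merges the curve of [x] with one of the two curves of the torus; when
   [b] holds, the surgery separates them again. The edge of [inr (inord 3)] is not
   affected by it: the next torus is attached there. *)
Definition step (b : bool) (D : finType) (M : dart_map D) (x : D) :
    dart_map (sum_darts D 'I_4) :=
  let S := connected_sum M x torus_collection (ord4 0) in
  if b then surgery S (inl (inl x)) (inl (inr (ord4 2))) else S.

Local Arguments step : simpl never.

Lemma old_eq (D : finType) (a c : D) :
  (inl (inl a) == inl (inl c) :> sum_darts D 'I_4) = (a == c).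
Proof. by []. Qed.

Section Step.
Variables (b : bool) (D : finType) (M : dart_map D) (x : D).
Hypothesis fM : four_valent M.

Local Notation T := torus_collection.
Local Notation old a := (inl (inl a) : sum_darts D 'I_4).
Local Notation tor k := (inl (inr (inord k)) : sum_darts D 'I_4).
Local Notation new k := (inr (inord k) : sum_darts D 'I_4).

Lemma rotation_step :
  [/\ forall a, rotation (step b M x) (old a) = old (rotation M a),
      forall k, k < 4 -> rotation (step b M x) (tor k) = tor (k.+1 %% 4)
    & forall k, k < 4 -> rotation (step b M x) (new k) = new (k.+1 %% 4)].
Proof.
have -> : rotation (step b M x) = rotation (connected_sum M x T (ord4 0)).
  by rewrite /step; case: b.
have [rold rtor rnew] := rotation_sum M x (ord4 0).
by split=> // k k4; rewrite rtor torusE.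
Qed.

Lemma tor_eq k l : k < 4 -> l < 4 -> (tor k == tor l) = (k == l).
Proof. exact: ord4_eq. Qed.

Lemma new_eq k l : k < 4 -> l < 4 -> (new k == new l) = (k == l).
Proof. exact: ord4_eq. Qed.

Lemma bar_step d : bar (step b M x) d =
  if b then
    if d == old x then new 1 else if d == new 1 then old x
    else if d == tor 2 then new 0 else if d == new 0 then tor 2
    else bar (connected_sum M x T (ord4 0)) d
  else bar (connected_sum M x T (ord4 0)) d.
Proof.
rewrite /step; case: b => //; rewrite ffunE bar_sum_old eqxx bar_sum_tor.
by rewrite ord4_eq //= bar_torus // eqxx.
Qed.

Lemma bar_step_old a : a != x -> a != bar M x ->
  bar (step b M x) (old a) = old (bar M a).
Proof.
move=> /negPf ax /negPf abx.
by rewrite bar_step old_eq ax /= bar_sum_old ax abx; case: b.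
Qed.

(** In [new b] the boolean is read as a number: the surgery moves the partner of [x] from half-edge
    0 of the new vertex to half-edge 1. *)
Lemma bar_step_cut :
  [/\ bar (step b M x) (old x) = new b,
      bar (step b M x) (old (bar M x)) = new 3
    & bar (step b M x) (new 3) = old (bar M x)].
Proof.
have [_ _ _ /(_ x)/negPf b1] := fM.
have [bn0 bn1 bn2 bn3] := bar_sum_new M x (ord4 0).
rewrite !bar_step !old_eq !eqxx b1 /= !new_eq // bn3 !bar_sum_old b1 !eqxx.
by case: b.
Qed.

Lemma bar_step_tor :
  [/\ bar (step b M x) (tor 0) = new 2, bar (step b M x) (tor 1) = tor 3,
      bar (step b M x) (tor 2) = new (~~ b) & bar (step b M x) (tor 3) = tor 1].
Proof.
rewrite !bar_step !tor_eq //= !bar_sum_tor !bar_torus // !ord4_eq //=.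
by case: b.
Qed.

Lemma bar_step_new :
  [/\ bar (step b M x) (new 0) = (if b then tor 2 else old x),
      bar (step b M x) (new 1) = (if b then old x else tor 2)
    & bar (step b M x) (new 2) = tor 0].
Proof.
have [bn0 bn1 bn2 bn3] := bar_sum_new M x (ord4 0).
rewrite !bar_step !new_eq //= bn0 bn1 bn2 bar_torus //.
by case: b.
Qed.

Lemma four_valent_step : four_valent (step b M x).
Proof.
have [r4 r2 b2 b1] := fM.
have [rold rtor rnew] := rotation_step.
have [bx bbx bn3] := bar_step_cut.
have [bt0 bt1 bt2 bt3] := bar_step_tor.
have [bn0 bn1 bn2] := bar_step_new.
split.
- case=> [[a|t]|i]; first by rewrite /= !rold; congr (old _); exact: r4.
    by elim/ord4_ind: t; rewrite /= !rtor.
  by elim/ord4_ind: i; rewrite /= !rnew.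
- case=> [[a|t]|i]; first by rewrite !rold; exact: r2.
    by elim/ord4_ind: t; rewrite !rtor // tor_eq.
  by elim/ord4_ind: i; rewrite !rnew // new_eq.
- case=> [[a|t]|i].
  + case: (eqVneq a x) => [->|ax]; first by rewrite bx; case: b bn0 bn1.
    case: (eqVneq a (bar M x)) => [->|abx]; first by rewrite bbx bn3.
    rewrite !bar_step_old ?b2 //; last by rewrite (inj_eq (can_inj b2)).
    by apply: contraNneq abx => <-; rewrite b2.
  + elim/ord4_ind: t; rewrite ?(bt0, bt1, bt2, bt3) //.
    by case: b bn0 bn1.
  + elim/ord4_ind: i; rewrite ?(bn0, bn1, bn2, bn3) //.
      by case: b bx bt2.
    by case: b bx bt2.
- case=> [[a|t]|i].
  + case: (eqVneq a x) => [->|ax]; first by rewrite bx.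
    case: (eqVneq a (bar M x)) => [->|abx]; first by rewrite bbx.
    by rewrite bar_step_old //; exact: b1.
  + by elim/ord4_ind: t; rewrite ?(bt0, bt1, bt2, bt3) // tor_eq.
  + by elim/ord4_ind: i; rewrite ?(bn0, bn1, bn2, bn3) //=; case: b.
Qed.

(** The new boundary is the old one with two detours through the torus and the new vertex, one after
    [x] and one after [bar M x]. Following [h] along them shows that its restriction to the old
    darts is invariant under [next_side M]; every new dart lies on one of the detours. *)
Lemma connected_boundary_step :
  connected_boundary M -> connected_boundary (step b M x).
Proof.
move=> cM h hS.
have [r4 r2 b2 b1] := fM.
have [rold rtor rnew] := rotation_step.
have [bx bbx bn3] := bar_step_cut.
have [bt0 bt1 bt2 bt3] := bar_step_tor.
have [bn0 bn1 bn2] := bar_step_new.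
have hS' d d' : rotation (step b M x) (bar (step b M x) d) = d' -> h d' = h d.
  by move=> <-; exact: hS.
have nx0 : h (new b.+1) = h (old x) by apply: hS'; rewrite bx rnew //; case: (b).
have nbx : h (new 0) = h (old (bar M x)) by apply: hS'; rewrite bbx rnew.
have n2 : h (tor 1) = h (new 2) by apply: hS'; rewrite bn2 rtor.
have n3 : h (old (rotation M (bar M x))) = h (new 3) by apply: hS'; rewrite bn3 rold.
have t0 : h (new 3) = h (tor 0) by apply: hS'; rewrite bt0 rnew.
have t1 : h (tor 0) = h (tor 1) by apply: hS'; rewrite bt1 rtor.
have t3 : h (tor 2) = h (tor 3) by apply: hS'; rewrite bt3 rtor.
have t2 : h (new (~~ b).+1) = h (tor 2) by apply: hS'; rewrite bt2 rnew //; case: (b).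
have n0 : h (if b then tor 3 else old (rotation M x)) = h (new 0).
  by apply: hS'; rewrite bn0 (fun_if (rotation _)) rtor // rold.
have n1 : h (if b then old (rotation M x) else tor 3) = h (new 1).
  by apply: hS'; rewrite bn1 (fun_if (rotation _)) rtor // rold.
have hx : h (old (rotation M (bar M x))) = h (old x).
  by rewrite n3 t0 t1 n2 -nx0; case: (b) n1 t2 => //= <- ->.
have hbx : h (old (rotation M x)) = h (old (bar M x)).
  by rewrite -nbx; case: (b) n0 n1 t2 => //= <- -> ->; rewrite t3.
have hold a w : h (old a) = h (old w).
  apply: (cM (fun a => h (old a))) => z; rewrite /next_side.
  case: (eqVneq z x) => [-> //|zx].
  case: (eqVneq z (bar M x)) => [-> |zbx]; first by rewrite b2.
  by apply: hS'; rewrite bar_step_old // rold.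
suff hall d : h d = h (old x) by move=> d d'; rewrite !hall.
have e3 : h (new 3) = h (old x) by rewrite -n3 hx.
have e0 : h (new 0) = h (old x) by rewrite nbx; exact: hold.
have et3 : h (tor 3) = h (old x).
  by case: (b) n0 n1 nx0 => /= [-> _ _ //|_ -> //].
have e1 : h (new 1) = h (old x).
  by case: (b) n1 => /= <-; [exact: hold | exact: et3].
case: d => [[a|t]|i]; first exact: hold.
  by elim/ord4_ind: t; rewrite ?t3 ?et3 -?t1 -?t0 ?e3.
by elim/ord4_ind: i; rewrite -?n2 -?t1 -?t0.
Qed.

Lemma one_faced_step : one_faced M -> one_faced (step b M x).
Proof.
case/one_facedP => _ cM _; apply/one_facedP; split.
- exact: four_valent_step.
- exact: connected_boundary_step.
- by exists (old x).
Qed.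

End Step.

(** With the surgery, the upper bound is that of [card_colorings_surgery] applied to the sum; the
    lower bound exhibits enough colourings. *)
Lemma card_colorings_step (b : bool) (D : finType) (M : dart_map D) (x : D) :
  four_valent M -> #|colorings (step b M x)| = 2 ^ b.+1 * #|colorings M|.
Proof.
move=> fM; have sumE := card_colorings_sum x fM (ord4 0).
case: b; last by rewrite /step sumE.
have [_ _ b2 b1] := fM.
apply/eqP; rewrite eqn_leq; apply/andP; split.
  rewrite expnS -mulnA -sumE.
  have [_ _ _ sb1] := four_valent_step false x fM.
  have [bx _ _] := bar_step_cut false x fM.
  have [] := @card_colorings_surgery _ _ (inl (inl x)) (inl (inr (ord4 2)))
    (four_valent_step false x fM) isT; last by [].
  by rewrite bx.
have [rold rtor rnew] := rotation_step true M x.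
have [bx bbx bn3] := bar_step_cut true x fM.
have [bt0 bt1 bt2 bt3] := bar_step_tor true M x.
have [bn0 bn1 bn2] := bar_step_new true M x.
have -> : 2 ^ 2 * #|colorings M| =
    #|finset.setX (colorings M) [set: bool * bool]|.
  by rewrite cardsX cardsT card_prod card_bool mulnC.
(* The odd torus darts are the untouched loop. The even ones, with the even half-edges of the new
   vertex, form the curve that the surgery splits off; the odd half-edges of that vertex continue
   the curve of [x]. *)
apply: (leq_card_image (f := fun hb : {ffun D -> bool} * (bool * bool) =>
  [ffun d : sum_darts D 'I_4 => match d with
     | inl (inl a) => hb.1 a
     | inl (inr t) => if odd t then hb.2.1 else hb.2.2
     | inr i => if odd i then hb.1 x else hb.2.2 end])).
  case=> h [c1 c2]; rewrite finset.in_setX finset.in_setT andbT /= => /coloringsP[hb hr].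
  apply/coloringsP; split=> -[[a|t]|i].
  - case: (eqVneq a x) => [->|ax]; first by rewrite bx !ffunE inordK.
    case: (eqVneq a (bar M x)) => [->|abx]; last by rewrite bar_step_old // !ffunE hb.
    by rewrite bbx !ffunE inordK //= hb.
  - by elim/ord4_ind: t; rewrite ?(bt0, bt1, bt2, bt3) !ffunE !inordK.
  - by elim/ord4_ind: i; rewrite ?(bn0, bn1, bn2, bn3) !ffunE !inordK //= hb.
  - by rewrite !rold !ffunE hr.
  - by elim/ord4_ind: t; rewrite !rtor // !ffunE !inordK.
  - by elim/ord4_ind: i; rewrite !rnew // !ffunE !inordK.
case=> h [c1 c2] [k [d1 d2]] _ _ /= /ffunP e; congr (_, (_, _)).
- by apply/ffunP => a; have := e (inl (inl a)); rewrite !ffunE.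
- by have := e (inl (inr (ord4 1))); rewrite !ffunE inordK.
- by have := e (inl (inr (ord4 0))); rewrite !ffunE inordK.
Qed.

(** * Persistence of a switch under later attachments *)

(* The surgery avoids the edge of [x], so that it persists through connected
   sums at [x]. *)
Definition flipped (D : finType) (M M' : dart_map D) (x : D) : Prop :=
  exists u v, [/\ v != u, v != bar M u, M' = surgery M u v,
    x \notin [:: u; v; bar M u; bar M v]
  & bar M x \notin [:: u; v; bar M u; bar M v]].

Lemma eq_dart_map (D : finType) (M M' : dart_map D) :
  rotation M =1 rotation M' -> bar M =1 bar M' -> M = M'.
Proof. by case: M M' => [r b] [r' b'] /ffunP /= -> /ffunP /= ->. Qed.

Lemma bar_surgery (D : finType) (M : dart_map D) (x y z : D) :
  bar (surgery M x y) z =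
  if z == x then bar M y else if z == bar M y then x
  else if z == y then bar M x else if z == bar M x then y else bar M z.
Proof. by rewrite ffunE. Qed.

Lemma bar_surgery_out (D : finType) (M : dart_map D) (x y z : D) :
  z \notin [:: x; y; bar M x; bar M y] -> bar (surgery M x y) z = bar M z.
Proof.
rewrite !inE !negb_or => /and4P[/negPf zx /negPf zy /negPf zbx /negPf zby].
by rewrite ffunE zx zy zbx zby.
Qed.

(** The two surgeries rewire disjoint sets of darts. *)
Lemma surgeryC (D : finType) (M : dart_map D) (x y u v : D) :
  (forall z, bar M (bar M z) = z) ->
  x \notin [:: u; v; bar M u; bar M v] ->
  y \notin [:: u; v; bar M u; bar M v] ->
  surgery (surgery M u v) x y = surgery (surgery M x y) u v.
Proof.
move=> b2 xuv yuv; have bI := can_inj b2.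
have bE z w : (bar M z == w) = (z == bar M w) by rewrite -[w in LHS]b2 (inj_eq bI).
have buv z : z \notin [:: u; v; bar M u; bar M v] ->
    bar M z \notin [:: u; v; bar M u; bar M v].
  by rewrite !inE !bE !b2 !negb_or => /and4P[-> -> -> ->].
have [uxy vxy] : u \notin [:: x; y; bar M x; bar M y] /\
                 v \notin [:: x; y; bar M x; bar M y].
  have sym w w' : (w == bar M w') = (w' == bar M w) by rewrite -bE eq_sym.
  move: xuv yuv; rewrite !inE !negb_or (eq_sym u) (eq_sym v) (eq_sym u) (eq_sym v).
  rewrite (sym u) (sym v) (sym u) (sym v).
  by move=> /and4P[-> -> -> ->] /and4P[-> -> -> ->].
apply: eq_dart_map => z //.
have [zxy|zxy] := boolP (z \in [:: x; y; bar M x; bar M y]); last first.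
  have zxy' : z \notin [:: x; y; bar (surgery M u v) x; bar (surgery M u v) y].
    by rewrite !bar_surgery_out.
  rewrite (bar_surgery_out zxy').
  rewrite [LHS](bar_surgery M u v z) bar_surgery (bar_surgery_out zxy).
  by rewrite !(bar_surgery_out uxy, bar_surgery_out vxy, bar_surgery_out zxy).
have zuv : z \notin [:: u; v; bar (surgery M x y) u; bar (surgery M x y) v].
  rewrite (bar_surgery_out uxy) (bar_surgery_out vxy).
  have : [|| z == x, z == y, z == bar M x | z == bar M y] by move: zxy; rewrite !inE.
  by case/or4P => /eqP -> //; exact: buv.
rewrite (bar_surgery_out zuv).
rewrite [RHS](bar_surgery M x y z) bar_surgery.
rewrite !(bar_surgery_out xuv, bar_surgery_out yuv).
by move: zxy; rewrite !inE => /or4P[] /eqP ->; rewrite !eqxx; do ?case: eqP.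
Qed.

(** Among the old edges the sum cuts only that of [x], which the surgery leaves alone. *)
Lemma connected_sum_surgery (D : finType) (M : dart_map D) (x u v : D)
    (y : 'I_4) :
  (forall z, bar M (bar M z) = z) ->
  x \notin [:: u; v; bar M u; bar M v] ->
  bar M x \notin [:: u; v; bar M u; bar M v] ->
  connected_sum (surgery M u v) x torus_collection y =
  surgery (connected_sum M x torus_collection y) (inl (inl u)) (inl (inl v)).
Proof.
move=> b2 xuv bxuv.
have [bn0 bn1 bn2 bn3] := bar_sum_new M x y.
have [bn0' bn1' bn2' bn3'] := bar_sum_new (surgery M u v) x y.
have oldE w : w \in [:: u; v; bar M u; bar M v] ->
    bar (connected_sum M x torus_collection y) (inl (inl w)) = inl (inl (bar M w)).
  move=> wuv; rewrite bar_sum_old; case: eqP => [wx|_]; first by rewrite -wx wuv in xuv.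
  by case: eqP => // wx; rewrite -wx wuv in bxuv.
have [uE vE] :
    bar (connected_sum M x torus_collection y) (inl (inl u)) =
      inl (inl (bar M u)) /\
    bar (connected_sum M x torus_collection y) (inl (inl v)) =
      inl (inl (bar M v)).
  by split; apply: oldE; rewrite !inE eqxx ?orbT.
apply: eq_dart_map => -[[a|t]|i].
- by rewrite !ffunE.
- by rewrite !ffunE.
- by rewrite !ffunE.
- rewrite bar_sum_old (bar_surgery_out xuv).
  have [auv|auv] := boolP (a \in [:: u; v; bar M u; bar M v]); last first.
    by rewrite (bar_surgery_out auv) bar_surgery_out ?uE ?vE // bar_sum_old.
  have /negPf -> : a != x by apply: contraNneq xuv => <-.
  have /negPf -> : a != bar M x by apply: contraNneq bxuv => <-.
  by rewrite !bar_surgery uE vE (oldE _ auv) !old_eq !(fun_if inl).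
- by rewrite bar_surgery_out ?uE ?vE // !bar_sum_tor.
- rewrite bar_surgery_out ?uE ?vE //.
  by elim/ord4_ind: i; rewrite
    ?(bn0, bn1, bn2, bn3, bn0', bn1', bn2', bn3') ?(bar_surgery_out xuv).
Qed.

(** The switch rewires the edges of [x] and of torus dart 2 in the sum, whereas half-edge 3 of the
    new vertex is joined to [bar M x]. *)
Lemma flipped_step_base (D : finType) (M : dart_map D) (x : D) :
  four_valent M ->
  flipped (step false M x) (step true M x) (inr (ord4 3)).
Proof.
move=> fM; have [bx bbx bn3] := bar_step_cut false x fM.
have [_ _ bt2 _] := bar_step_tor false M x.
exists (inl (inl x)), (inl (inr (ord4 2))).
have nn i j : i < 4 -> j < 4 ->
    (inr (ord4 i) == inr (ord4 j) :> sum_darts D 'I_4) = (i == j).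
  by move=> i4 j4; apply: (ord4_eq i4 j4).
have [_ _ _ b1] := fM.
by split; rewrite ?bn3 ?bx ?bt2 // !inE ?nn //= orbF; exact: b1.
Qed.

(** An earlier surgery commutes with attaching the next torus by [connected_sum_surgery], and with
    switching that torus by [surgeryC]. *)
Lemma flipped_step (b : bool) (D : finType) (M M' : dart_map D) (x : D) :
  four_valent M -> flipped M M' x ->
  flipped (step b M x) (step b M' x) (inr (ord4 3)).
Proof.
move=> fM [u [v [vu vbu ->]]]; set uv := [:: u; v; bar M u; bar M v] => xuv bxuv.
have [_ _ b2 b1] := fM.
have [bx bbx bn3] := bar_step_cut b x fM.
have oldE c w : w \in uv ->
    bar (step c M x) (inl (inl w)) = inl (inl (bar M w)).
  by move=> wuv; rewrite bar_step_old //;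
    [apply: contraNneq xuv | apply: contraNneq bxuv] => <-.
have uE c : bar (step c M x) (inl (inl u)) = inl (inl (bar M u)).
  by apply: oldE; rewrite !inE eqxx ?orbT.
have vE c : bar (step c M x) (inl (inl v)) = inl (inl (bar M v)).
  by apply: oldE; rewrite !inE eqxx ?orbT.
exists (inl (inl u)), (inl (inl v)); split=> //; rewrite ?uE ?vE ?bn3 //.
have [_ _ stepK _] := four_valent_step false x fM.
have uF : bar (connected_sum M x torus_collection (ord4 0)) (inl (inl u)) = _ :=
  uE false.
have vF : bar (connected_sum M x torus_collection (ord4 0)) (inl (inl v)) = _ :=
  vE false.
rewrite /step connected_sum_surgery //; case: (b) => //.
rewrite surgeryC //; last by rewrite uF vF !inE.
by rewrite uF vF; move: xuv; rewrite !inE !old_eq.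
Qed.

Lemma flipped_relabel (D : finType) (n : nat) (cD : #|D| = n)
    (M M' : dart_map D) (x : D) :
  flipped M M' x -> flipped (relabel cD M) (relabel cD M') (label cD x).
Proof.
case=> u [v [vu vbu -> xuv bxuv]]; exists (label cD u), (label cD v).
have lE w :
    (label cD w \notin
       [:: label cD u; label cD v; label cD (bar M u); label cD (bar M v)]) =
    (w \notin [:: u; v; bar M u; bar M v]).
  by rewrite !inE !label_eq.
by split; rewrite ?bar_relabel ?label_eq ?relabel_surgery ?lE.
Qed.

(** * A grid in the surgery-sum graph *)

(** With [2 ^ k] colourings for [k] curves, the logarithm is the number of curves; truncation lets
    doubling inequalities between numbers of colourings suffice. *)
Definition curves (v : Kinf_vertex) : nat :=
  trunc_log 2 #|colorings (val (repr (tagged v)))|.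

Lemma curves_mk g (G : collection g) :
  curves (Kinf_mk (class_of G)) = trunc_log 2 #|colorings (val G)|.
Proof.
congr trunc_log; apply: card_colorings_homeo.
suff : homeo (repr (class_of G)) G by [].
by apply/eqmodP; rewrite reprK.
Qed.

Lemma trunc_log2_leS n n' : n <= 2 * n' -> trunc_log 2 n <= (trunc_log 2 n').+1.
Proof.
case: n' => [|n'] nn'; first by move: nn'; rewrite muln0 leqn0 => /eqP ->.
by rewrite -trunc_logMp //; exact: leq_trunc_log.
Qed.

Lemma one_faced_four_valent (D : finType) (M : dart_map D) :
  one_faced M -> four_valent M.
Proof. by case/one_facedP. Qed.

Lemma curves_edge (u v : Kinf_vertex) :
  Kinf_edge u v -> curves u <= (curves v).+1.
Proof.
suff link w w' : Kinf_link w w' ->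
    curves w <= (curves w').+1 /\ curves w' <= (curves w).+1.
  by case=> /link[].
case=> [g G H x y yx ybx HE _ | g G H x y /card_colorings_homeo GH].
  rewrite !curves_mk HE.
  by have [] := card_colorings_surgery (one_faced_four_valent (valP G)) yx ybx;
    split; exact: trunc_log2_leS.
rewrite !curves_mk -GH card_colorings_sum; last exact: one_faced_four_valent (valP G).
by split; apply: trunc_log2_leS => //; rewrite mulnA leq_pmull.
Qed.

Lemma genus_edge (u v : Kinf_vertex) : Kinf_edge u v -> tag u <= (tag v).+1.
Proof. by case=> -[] *; rewrite /= ?leqnn // ltnW // ltnW. Qed.

Lemma card_sum_darts m : #|sum_darts 'I_(8 * m.+1 - 4) 'I_4| = 8 * m.+2 - 4.
Proof. by rewrite !card_sum !card_ord; lia. Qed.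

Fixpoint mark (m : nat) : 'I_(8 * m.+1 - 4) :=
  match m with
  | 0 => ord4 0
  | m.+1 => label (card_sum_darts m) (inr (ord4 3))
  end.

(** The index is the genus minus 1, and [b i] tells whether the torus attached to [chain b i] is
    switched. *)
Fixpoint chain (b : nat -> bool) (m : nat) : dart_map 'I_(8 * m.+1 - 4) :=
  match m with
  | 0 => torus_collection
  | m.+1 => relabel (card_sum_darts m) (step (b m) (chain b m) (mark m))
  end.

Lemma one_faced_chain b m : one_faced (chain b m).
Proof.
elim: m => [|m IHm]; first exact: one_faced_torus.
by apply: one_faced_relabel; apply: one_faced_step => //; exact: one_faced_four_valent.
Qed.

Lemma four_valent_chain b m : four_valent (chain b m).
Proof. exact/one_faced_four_valent/one_faced_chain. Qed.

Lemma eq_chain b b' m : (forall i, i < m -> b i = b' i) -> chain b m = chain b' m.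
Proof.
elim: m => //= m IHm bb'; rewrite bb' // IHm // => i im.
by apply: bb'; exact: ltnW.
Qed.

(** The chains agree until the torus governed by [b j] is attached; the surgery appears there and is
    carried through all later attachments. *)
Lemma flipped_chain b b' j m :
  (forall i, i != j -> b i = b' i) -> b j = false -> b' j = true -> j < m ->
  flipped (chain b m) (chain b' m) (mark m).
Proof.
move=> bb' bj b'j; elim: m => // m IHm; rewrite ltnS leq_eqVlt => /orP[/eqP jm|jm].
  rewrite -jm /= bj b'j.
  rewrite (@eq_chain b' b); last by move=> i ij; rewrite bb' // ltn_eqF.
  exact/flipped_relabel/flipped_step_base/four_valent_chain.
apply: flipped_relabel; rewrite bb' ?gtn_eqF //; apply: flipped_step (IHm jm).
exact: four_valent_chain.
Qed.

(* [m] tori are added to the first one, and the first [j] of them are switched. *)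
Definition chain_vertex (m j : nat) : Kinf_vertex :=
  Kinf_mk (class_of (exist _ (chain (fun i => i < j) m)
                             (one_faced_chain _ m) : collection m.+1)).

Lemma card_colorings_gt0 (D : finType) (M : dart_map D) : 0 < #|colorings M|.
Proof.
apply/card_gt0P; exists [ffun=> true].
by apply/coloringsP; split=> z; rewrite !(ffunE (fun=> true)).
Qed.

(** Only differences of [curves] matter, so the value at the base stays symbolic. *)
Lemma curves_chain m j :
  curves (chain_vertex m j) = curves (chain_vertex 0 0) + m + minn j m.
Proof.
rewrite !curves_mk /=; elim: m => [|m IHm]; first by rewrite minn0 !addn0.
rewrite /= -(card_colorings_homeo (homeomorphic_relabel _ _)).
rewrite card_colorings_step; last exact: four_valent_chain.
have gt0 := card_colorings_gt0 (chain (fun i => i < j) m).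
rewrite expnS -mulnA trunc_logMp ?muln_gt0 ?expn_gt0 //.
case: ltnP => [mj|jm].
  rewrite expn1 trunc_logMp // IHm; lia.
rewrite expn0 mul1n IHm; lia.
Qed.

Lemma chain_sum_edge m j : j <= m ->
  Kinf_edge (chain_vertex m j) (chain_vertex m.+1 j).
Proof.
move=> jm; left; apply: (@sum_link _ _ _ (mark m) (ord4 0)) => /=.
(* Since [j <= m], the last torus is unswitched and the step is a plain connected sum. *)
by rewrite ltnNge jm; exact: homeomorphic_relabel.
Qed.

Lemma chain_surgery_edge m j : j < m ->
  Kinf_edge (chain_vertex m j) (chain_vertex m j.+1).
Proof.
move=> jm; left.
have [i ij | | | u [v [vu vbu chainE _ _]]] :=
  @flipped_chain (fun i => i < j) (fun i => i < j.+1) j m _ _ _ jm.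
- by rewrite ltnS [RHS]leq_eqVlt; case: eqP ij => // ->; rewrite eqxx.
- exact: ltnn.
- exact: ltnSn.
(* A surgery edge must join distinct classes; the number of curves tells them apart. *)
apply: (@surgery_link _ _ _ u v) => // eq_class.
have : curves (chain_vertex m j) = curves (chain_vertex m j.+1).
  by rewrite /chain_vertex eq_class.
rewrite (curves_chain m j) (curves_chain m j.+1); lia.
Qed.

Import Order.TTheory GRing.Theory Num.Theory.
Local Open Scope classical_set_scope.
Local Open Scope ring_scope.

(** * Geodesics in the realization of a graph *)

(** A bigon is a triangle whose third side is constant at [a], and [a] already lies on [T]. *)
Lemma gromov_hyperbolic_bigon (R : realType) (X : Type) (d : X -> X -> \bar R) :
  gromov_hyperbolic d ->
  exists2 delta, 0 <= delta &
    forall (a b : X) (S T : set X), d a a = 0%E ->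
      geodesic_segment d a b S -> geodesic_segment d b a T ->
      S `<=` neighborhood d delta T.
Proof.
case=> delta delta0 hyp; exists delta => // a b S T daa abS baT.
have Ta : T a.
  have [l [c [l0 _ cl _ ->]]] := baT.
  by exists l; [apply/andP; split | exact: cl].
have aa : geodesic_segment d a a [set a].
  exists 0, (fun=> a); split=> //.
    by move=> s t /le_anti <- /le_anti <-; rewrite daa subrr normr0.
  by apply/seteqP; split=> [_ -> | _ [_ _ <-]] //; exists 0; rewrite /= ?lexx.
have [_ + _] := hyp _ _ _ _ _ _ aa abS baT.
by move=> sub p /sub[q [Tq|->] pq]; [exists q | exists a].
Qed.

Section GraphGeodesics.
Variables (R : realType) (V : choiceType) (e : V -> V -> Prop).

(** Barycentric coordinates have finite support, so this finitely supported sum extends [phi]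
    affinely over each edge. *)
Definition affine_extension (phi : V -> R) (p : V -> R) : R :=
  \sum_(w \in [set: V]) p w * phi w.

Lemma affine_extension_edge (phi : V -> R) (u v : V) (t : R) :
  affine_extension phi (edge_point u v t) = (1 - t) * phi u + t * phi v.
Proof.
(* Removing duplicates accounts for the degenerate edge [u = v]. *)
rewrite /affine_extension (fsbigE (undup [:: u; v])) ?undup_uniq //; last first.
  move=> w _; rewrite mem_undup !inE negb_or /edge_point => /andP[/negPf -> /negPf ->].
  by rewrite !mulr0 addr0 mul0r.
rewrite big_seq_cond (eq_bigl (fun w => w \in undup [:: u; v])); last first.
  by move=> w; rewrite in_setT andbT.
rewrite -big_seq /edge_point /= inE; have [->|uv] := eqVneq u v.
  by rewrite big_seq1 eqxx !mulr1 mulrDl.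
by rewrite big_cons big_seq1 !eqxx (eq_sym v) (negPf uv) !mulr1 !mulr0 addr0 add0r.
Qed.

(** On each edge the extension has slope at most 1 in absolute value. *)
Lemma polyline_affine_extension (phi : V -> R) (p q : V -> R) (l : R) :
  (forall u v, e u v -> `|phi u - phi v| <= 1) -> polyline e p q l ->
  `|affine_extension phi p - affine_extension phi q| <= l.
Proof.
move=> phi1; elim=> [{}p|u v s t {}q {}l uv _ _ _ IH]; first by rewrite subrr normr0.
apply: le_trans (ler_distD (affine_extension phi (edge_point u v t)) _ _) _.
apply: lerD IH; rewrite !affine_extension_edge.
rewrite (_ : _ - _ = (t - s) * (phi u - phi v)); last by ring.
by rewrite normrM distrC ler_piMr // phi1.
Qed.

Lemma graph_dist_ge (phi : V -> R) (p q : graph_point R e) :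
  (forall u v, e u v -> `|phi u - phi v| <= 1) ->
  (`|affine_extension phi (sval p) - affine_extension phi (sval q)|%:E <=
   graph_dist p q)%E.
Proof.
move=> phi1; apply: le_ereal_inf_tmp => _ [l pql <-].
by rewrite lee_fin; exact: polyline_affine_extension pql.
Qed.

Section Ray.
Variable v : nat -> V.
Hypothesis ev : forall i, e (v i) (v i.+1).

(* The absolute value only makes the definition total. *)
Definition ray_coord (x : R) : V -> R :=
  let k := Num.trunc `|x| in edge_point (v k) (v k.+1) (`|x| - k%:R).

Lemma trunc_frac (x : R) : 0 <= x -> 0 <= x - (Num.trunc x)%:R <= 1.
Proof.
move=> /truncn_itv; rewrite -natr1 => /andP[kx xk].
by rewrite subr_ge0 kx lerBlDl ltW.
Qed.

Lemma is_graph_point_ray x : is_graph_point e (ray_coord x).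
Proof.
pose k := Num.trunc `|x|; exists (v k), (v k.+1), (`|x| - k%:R).
by split; [right | exact: trunc_frac |].
Qed.

Lemma ray_coord_nat i : ray_coord i%:R = edge_point (v i) (v i) 0.
Proof.
rewrite /ray_coord ger0_norm // natrK subrr; apply: funext => w.
by rewrite /edge_point !mul0r.
Qed.

Definition ray (x : R) : graph_point R e := exist _ _ (is_graph_point_ray x).

Lemma edge_point_end i :
  edge_point (v i) (v i.+1) 1 = edge_point (v i.+1) (v i.+2) 0 :> (V -> R).
Proof. by apply: funext => w; rewrite /edge_point; ring. Qed.

(** A [polyline] is built from its initial point, so the induction peels the first edge off the
    forward path and the last edge of the ray segment off the backward one. *)
Lemma polyline_edges (i n : nat) (s t : R) : 0 <= s <= 1 -> 0 <= t <= 1 ->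
  polyline e (edge_point (v i) (v i.+1) s)
    (edge_point (v (i + n)%N) (v (i + n).+1) t) `|s - (n%:R + t)| /\
  polyline e (edge_point (v (i + n)%N) (v (i + n).+1) t)
    (edge_point (v i) (v i.+1) s) `|s - (n%:R + t)|.
Proof.
have I0 : 0 <= (0 : R) <= 1 by rewrite lexx ler01.
have I1 : 0 <= (1 : R) <= 1 by rewrite lexx ler01.
elim: n i s t => [|n IHn] i s t s01 t01.
  rewrite addn0 add0r; split; [|rewrite distrC]; rewrite -[`|_|]addr0;
    by apply: polyline_cons (ev i) _ _ _ => //; exact: polyline_nil.
move: (s01) (t01) => /andP[s0 s1] /andP[t0 t1].
have n0 : 0 <= n%:R :> R by rewrite ler0n.
have lenE : `|s - (n.+1%:R + t)| = `|s - 1| + `|0 - (n%:R + t)|.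
  rewrite -natr1 !ler0_norm; [ring | lra | lra | lra].
have lenE' : `|s - (n.+1%:R + t)| = `|t - 0| + `|s - (n%:R + 1)|.
  rewrite -natr1 [`|t - 0|]ger0_norm ?subr0 // !ler0_norm; [ring | lra | lra].
split.
  rewrite lenE; apply: polyline_cons (ev i) s01 I1 _.
  by rewrite edge_point_end addnS -addSn; case: (IHn i.+1 0 t I0 t01).
rewrite lenE' addnS; apply: polyline_cons (ev _) t01 I0 _.
by rewrite -edge_point_end; case: (IHn i s 1 s01 I1).
Qed.

Lemma polyline_ray (x y : R) : 0 <= x -> 0 <= y ->
  polyline e (ray_coord x) (ray_coord y) `|x - y|.
Proof.
move=> x0 y0; rewrite /ray_coord (ger0_norm x0) (ger0_norm y0).
set i := Num.trunc x; set j := Num.trunc y.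
have x01 := trunc_frac x0; have y01 := trunc_frac y0.
have [ij|/ltnW ji] := leqP i j.
  have [p _] := polyline_edges i (j - i) x01 y01; rewrite subnKC // in p.
  suff -> : x - y = x - i%:R - ((j - i)%:R + (y - j%:R)) by [].
  by rewrite natrB //; ring.
have [_ p] := polyline_edges j (i - j) y01 x01; rewrite subnKC // in p.
suff -> : x - y = - (y - j%:R - ((i - j)%:R + (x - i%:R))) by rewrite normrN.
by rewrite natrB //; ring.
Qed.

Variable phi : V -> R.
Hypothesis phi1 : forall u w, e u w -> `|phi u - phi w| <= 1.
Hypothesis phi_ray : forall i, phi (v i) = phi (v 0%N) + i%:R.

Lemma affine_extension_ray (x : R) : 0 <= x ->
  affine_extension phi (ray_coord x) = phi (v 0%N) + x.
Proof.
move=> x0; rewrite affine_extension_edge ger0_norm // phi_ray [phi (v _.+1)]phi_ray -natr1.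
ring.
Qed.

(** The ray itself gives the upper bound; [phi], which is 1-Lipschitz and grows at unit speed along
    the ray, gives the lower one. *)
Lemma graph_dist_ray (x y : R) : 0 <= x -> 0 <= y ->
  graph_dist (ray x) (ray y) = `|x - y|%:E.
Proof.
move=> x0 y0; apply/eqP; rewrite eq_le; apply/andP; split.
  apply: ge_ereal_inf; exists `|x - y|%:E => //.
  by exists `|x - y| => //; exact: polyline_ray.
apply: le_trans (graph_dist_ge _ _ phi1); rewrite !affine_extension_ray //.
by rewrite lee_fin opprD addrACA subrr add0r.
Qed.

Lemma geodesic_ray (m : R) : 0 <= m ->
  geodesic_segment (@graph_dist R V e) (ray 0) (ray m)
    (ray @` [set s | 0 <= s <= m]) /\
  geodesic_segment (@graph_dist R V e) (ray m) (ray 0)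
    (ray @` [set s | 0 <= s <= m]).
Proof.
move=> m0; split.
  exists m, ray; split=> // s t /andP[s0 _] /andP[t0 _]; exact: graph_dist_ray.
exists m, (fun s => ray (m - s)); split; rewrite ?subr0 ?subrr //.
  move=> s t /andP[_ sm] /andP[_ tm]; rewrite graph_dist_ray ?subr_ge0 //.
  by rewrite distrC; congr (`|_|%:E); ring.
apply/seteqP; split=> _ [s /andP[s0 sm] <-]; exists (m - s).
- by apply/andP; split; lra.
- by rewrite subKr.
- by apply/andP; split; lra.
- by [].
Qed.

End Ray.
End GraphGeodesics.

(** * Two geodesics with common endpoints and their divergence *)

(* Both paths meet again at [i = 2 * n]; going on forever with connected sums
   makes them rays, which avoids a special case at the end of a geodesic. *)
Definition sums_first (n i : nat) : Kinf_vertex :=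
  chain_vertex (n + minn i n + (i - 2 * n))%N (minn (i - n) n).

Definition surgeries_first (n i : nat) : Kinf_vertex :=
  chain_vertex (n + (i - n))%N (minn i n).

Lemma chain_edge (m j m' j' : nat) :
  [\/ [/\ m' = m.+1, j' = j & (j <= m)%N] | [/\ m' = m, j' = j.+1 & (j < m)%N]] ->
  Kinf_edge (chain_vertex m j) (chain_vertex m' j').
Proof.
case=> -[-> -> jm]; [exact: chain_sum_edge | exact: chain_surgery_edge].
Qed.

Lemma sums_first_edge n i : Kinf_edge (sums_first n i) (sums_first n i.+1).
Proof.
apply: chain_edge; have [ni|ni] := leqP n i; last by left; split; lia.
by have [ni'|ni'] := leqP (2 * n) i; [left | right]; split; lia.
Qed.

Lemma surgeries_first_edge n i :
  Kinf_edge (surgeries_first n i) (surgeries_first n i.+1).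
Proof.
by apply: chain_edge; have [ni|ni] := leqP n i; [left | right]; split; lia.
Qed.

Lemma curves_sums_first n i :
  curves (sums_first n i) = (curves (sums_first n 0) + i)%N.
Proof.
rewrite (curves_chain (n + minn i n + _)) (curves_chain (n + minn 0 n + _)); lia.
Qed.

Lemma curves_surgeries_first n i :
  curves (surgeries_first n i) = (curves (surgeries_first n 0) + i)%N.
Proof. rewrite (curves_chain (n + (i - n))) (curves_chain (n + (0 - n))); lia. Qed.

Lemma Kinf_edge_sym u v : Kinf_edge u v -> Kinf_edge v u.
Proof. by case; [right | left]. Qed.

Lemma dist_nat_le1 (R : realType) (a b : nat) :
  (a <= b.+1)%N -> (b <= a.+1)%N -> `|a%:R - b%:R : R| <= 1.
Proof.
rewrite -(ler_nat R) -(ler_nat R b) -!natr1 ler_norml => ab ba.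
by apply/andP; split; lra.
Qed.

Theorem theorem4 (R : realType) : ~ gromov_hyperbolic (@Kinf_dist R).
Proof.
case/gromov_hyperbolic_bigon => delta delta0 hyp.
(* For a point at parameter [s] within [delta] of the corner, curves will give [n - s <= delta], and
   genus, with a loss of at most 1 from truncating [s], will give [s <= delta + 1] or
   [n <= delta]. *)
have [n n_gt] : exists n : nat, 2 * delta + 1 < n%:R.
  exists (Num.trunc (2 * delta + 1)).+1.
  by have /truncn_itv/andP[] : 0 <= 2 * delta + 1 by lra.
have eA := sums_first_edge n; have eB := surgeries_first_edge n.
have [k [k1 kA kB]] : exists k : Kinf_vertex -> R,
    [/\ forall u w, Kinf_edge u w -> `|k u - k w| <= 1,
        forall i, k (sums_first n i) = k (sums_first n 0%N) + i%:R
      & forall i, k (surgeries_first n i) = k (surgeries_first n 0%N) + i%:R].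
  exists (fun w => (curves w)%:R); split=> [u w uw | i | i].
  - by apply: dist_nat_le1; apply: curves_edge; last exact: Kinf_edge_sym.
  - by rewrite curves_sums_first natrD.
  - by rewrite curves_surgeries_first natrD.
(* Allowing every [c >= i] bounds the genus at both ends of the edge that contains the point at
   parameter [s]. *)
have [g [g1 gA gB]] : exists g : Kinf_vertex -> R,
    [/\ forall u w, Kinf_edge u w -> `|g u - g w| <= 1,
        forall i c, (i <= c)%N -> n%:R + 1 + (minn i n)%:R <= g (sums_first n c)
      & g (surgeries_first n n) = n%:R + 1].
  exists (fun w => (tag w)%:R); split=> [u w uw | i c ic | ].
  - by apply: dist_nat_le1; apply: genus_edge; last exact: Kinf_edge_sym.
  - by rewrite natr1 -natrD ler_nat /=; lia.
  - by rewrite /= subnn addn0 -natr1.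
have start : sums_first n 0 = surgeries_first n 0.
  by rewrite /sums_first /surgeries_first; congr chain_vertex; lia.
have stop : sums_first n (2 * n) = surgeries_first n (2 * n).
  by rewrite /sums_first /surgeries_first; congr chain_vertex; lia.
move: (sums_first n) (surgeries_first n) eA eB start stop kA kB gA gB.
move=> v w eA eB start stop kA kB gA gB.
have n0 : 0 <= n%:R :> R by exact: ler0n.
have m0 : 0 <= (2 * n)%:R :> R by exact: ler0n.
have AB0 : ray eA 0 = ray eB 0 :> graph_point R _.
  by apply: eq_exist; rewrite !(ray_coord_nat _ _ 0) start.
have ABm : ray eA (2 * n)%:R = ray eB (2 * n)%:R :> graph_point R _.
  by apply: eq_exist; rewrite !ray_coord_nat stop.
have [_ A_geo] := geodesic_ray eA k1 kA m0.
have [B_geo _] := geodesic_ray eB k1 kB m0.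
rewrite AB0 ABm in A_geo.
have B00 : graph_dist (ray eB 0) (ray eB 0) = 0%E :> \bar R.
  by have := graph_dist_ray eB k1 kB (lexx 0) (lexx 0); rewrite subrr normr0.
(* At parameter [n] the second path has made all its surgeries and no sum. *)
have corner : (ray eB @` [set s : R | 0 <= s <= (2 * n)%:R]) (ray eB n%:R).
  by apply: imageP; apply/andP; split; [exact: n0 | rewrite ler_nat leq_pmull].
have [_ [s /andP[s0 _] <-] dq] := hyp _ _ _ _ B00 B_geo A_geo _ corner.
have kp : affine_extension k (sval (ray eA s)) = k (v 0%N) + s.
  exact: (affine_extension_ray kA s0).
have kq : affine_extension k (sval (ray eB n%:R)) = k (w 0%N) + n%:R.
  exact: (affine_extension_ray kB n0).
have gp : affine_extension g (sval (ray eA s)) =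
    (1 - (s - (Num.trunc s)%:R)) * g (v (Num.trunc s)) +
    (s - (Num.trunc s)%:R) * g (v (Num.trunc s).+1).
  by rewrite -[in RHS](ger0_norm s0); exact: affine_extension_edge.
have gq : affine_extension g (sval (ray eB n%:R)) = g (w n).
  by rewrite [sval _]ray_coord_nat affine_extension_edge mul0r addr0 subr0 mul1r.
move: (ray eA s) (ray eB n%:R) kp kq gp gq dq => p q kp kq gp gq dq.
have := le_trans (graph_dist_ge _ _ k1) dq; rewrite lee_fin kp kq start => k_le.
have := le_trans (graph_dist_ge _ _ g1) dq; rewrite lee_fin gp gq => g_le.
move: k_le g_le; set i := Num.trunc s; set u := s - i%:R.
have /andP[u0 u1] : 0 <= u <= 1 := trunc_frac s0.
have gi := gA i i (leqnn i); have gi1 := gA i i.+1 (leqnSn i).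
rewrite gB !ler_norml => /andP[_ k_le] /andP[g_le _].
have su : s = i%:R + u by rewrite addrC subrK.
clearbody u i.
(* Inside an edge the genus is a convex combination of two values with the same lower bound. *)
have gu : (1 - u) * (n%:R + 1 + (minn i n)%:R) + u * (n%:R + 1 + (minn i n)%:R) <=
    (1 - u) * g (v i) + u * g (v i.+1).
  by apply: lerD; [apply: ler_wpM2l gi; rewrite subr_ge0 | apply: ler_wpM2l gi1].
by move: gu; case: leqP => in_; lra.
Qed.
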